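(* Let $q,\beta>0$, $0<\alpha<1$, $n\in\mathbb{N}$ with $n^{1-\alpha}>2$, $x\in\mathbb{R}$, $N\in\mathbb{N}$, and $f\in C^N(\mathbb{R})$ with $f^{(N)}\in C_B(\mathbb{R})$. Let $r\in\mathbb{N}$ and weights $w_1,\dots,w_r\ge0$ with $\sum_{j=1}^r w_j=1$ be given. Put $$\sigma_n:=\omega\left(f^{(N)},\frac1n+\frac1{n^\alpha}\right)\frac{\left(\frac1n+\frac1{n^\alpha}\right)^N}{N!}+\frac{2^N\|f^{(N)}\|_\infty}{n^N N!}\left(q+\frac1q\right)e^{\beta}e^{-\frac{\beta n^{1-\alpha}}{2}}\left[1+\frac{2^{N+1}N!}{\beta^N}\right].$$ Then: (i) $$\left|\overline{B_n}(f)(x)-f(x)-\sum_{k=1}^N\frac{f^{(k)}(x)}{k!}\overline{B_n}\left((\cdot-x)^k\right)(x)\right|\le\sigma_n,$$ and $\sigma_n\to0$ as $n\to\infty$. (ii) If $f^{(k)}(x)=0$ for $k=1,\dots,N$, then $|\overline{B_n}(f)(x)-f(x)|\le\sigma_n$. (iii) $$|\overline{B_n}(f)(x)-f(x)|\le\sum_{k=1}^N\frac{|f^{(k)}(x)|}{k!}\frac{2^{k-1}}{n^k}\left[1+\frac{1-e^{-\beta}}{1+e^{-\beta}}\cdot\frac1{k+1}+\left(q+\frac1q\right)\frac{e^\beta k!}{\beta^k}\right]+\sigma_n.$$ (iv) $$\|\overline{B_n}(f)-f\|_\infty\le\sum_{k=1}^N\frac{\|f^{(k)}\|_\infty}{k!}\frac{2^{k-1}}{n^k}\left[1+\frac{1-e^{-\beta}}{1+e^{-\beta}}\cdot\frac1{k+1}+\left(q+\frac1q\right)\frac{e^\beta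 k!}{\beta^k}\right]+\sigma_n.$$
   Context: $\mathbb{N}=\{1,2,\dots\}$. For $q,\beta>0$ and $x\in\mathbb{R}$ let $\nu_{q}(x)=\frac{1-qe^{-\beta x}}{1+qe^{-\beta x}}$ and $G_{q,\beta}(x)=\frac14\left(\nu_{q}(x+1)-\nu_{q}(x-1)\right)$; $G_{1/q,\beta}$ is the same with $q$ replaced by $1/q$. Let $\Psi=\frac12\left(G_{q,\beta}+G_{1/q,\beta}\right)$ (an even probability density on $\mathbb{R}$). $C_B(\mathbb{R})$ is the set of continuous bounded real functions on $\mathbb{R}$; $C^N(\mathbb{R})$ is the set of $N$ times continuously differentiable real functions. $\|g\|_\infty=\sup_{x\in\mathbb{R}}|g(x)|\in[0,\infty]$ (the bound (iv) is vacuous if some $\|f^{(k)}\|_\infty$ is infinite). For $\theta>0$, $\omega(g,\theta)=\sup\{|g(x)-g(y)|: x,y\in\mathbb{R},\ |x-y|\le\theta\}$. The (quadrature type) operator $\overline{B_n}$ is $$\overline{B_n}(f)(x)=\int_{-\infty}^{\infty}\left(\sum_{j=1}^r w_j f\left(\frac vn+\frac{j}{nr}\right)\right)\Psi(nx-v)\,dv ,$$ applied also to unbounded functions for which the integral converges absolutely; in particular $\overline{B_n}\left((\cdot-x)^k\right)(x)=\int_{-\infty}^\infty\left(\sum_{j=1}^r w_j\left(\frac vn+\frac j{nr}-x\right)^k\right)\Psi(nx-v)\,dv$. *)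

(* Defs.v *)
From HB Require Import structures.
From mathcomp Require Import all_boot all_order all_algebra.
From mathcomp Require Import all_classical all_reals all_analysis.

Set Implicit Arguments.
Unset Strict Implicit.
Unset Printing Implicit Defensive.

Import Order.TTheory GRing.Theory Num.Theory.
Import numFieldNormedType.Exports.

Local Open Scope ring_scope.
Local Open Scope classical_set_scope.

Definition nu (R : realType) (q beta x : R) : R :=
  (1 - q * expR (- (beta * x))) / (1 + q * expR (- (beta * x))).

Definition G (R : realType) (q beta x : R) : R :=
  4^-1 * (nu q beta (x + 1) - nu q beta (x - 1)).

Definition Psi (R : realType) (q beta x : R) : R :=
  2^-1 * (G q beta x + G q^-1 beta x).

Definition Cdiff (R : realType) (N : nat) (f : R -> R) : Prop :=
  (forall k, (k < N)%N -> forall x : R, derivable (f^`(k)) x 1) /\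
  continuous (f^`(N)).

Definition CB (R : realType) (g : R -> R) : Prop :=
  continuous g /\ bounded_fun g.

Local Open Scope ereal_scope.

(* Both suprema are over nonempty sets of nonnegative numbers (for
   [0 <= theta]), so they take values in [0, +oo]. *)
Definition supnorm (R : realType) (g : R -> R) : \bar R :=
  ereal_sup [set `|g x|%:E | x in [set: R]].

Definition omega (R : realType) (g : R -> R) (theta : R) : \bar R :=
  ereal_sup [set `|g p.1 - g p.2|%:E |
             p in [set p : R * R | (`|p.1 - p.2| <= theta)%R]].

Local Close Scope ereal_scope.

Definition quad_integrand (R : realType) (q beta : R) (r : nat) (w : nat -> R)
    (n : nat) (f : R -> R) (x v : R) : R :=
  (\sum_(1 <= j < r.+1) w j * f (v / n%:R + j%:R / (n * r)%:R))
  * Psi q beta (n%:R * x - v).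

Definition quad_converges (R : realType) (q beta : R) (r : nat) (w : nat -> R)
    (n : nat) (f : R -> R) (x : R) : Prop :=
  lebesgue_measure.-integrable [set: R]
    (fun v => (quad_integrand q beta r w n f x v)%:E).

(* Meaningful only under [quad_converges]: [Rintegral] sends an infinite
   integral to 0. *)
Definition quad_op (R : realType) (q beta : R) (r : nat) (w : nat -> R)
    (n : nat) (f : R -> R) (x : R) : R :=
  \int[lebesgue_measure]_(v in [set: R]) quad_integrand q beta r w n f x v.

(* Extended-real valued because [omega] and [supnorm] are; it is finite as soon
   as the [N]-th derivative is bounded and [0 < n]. *)
Definition sigma (R : realType) (q beta alpha : R) (N : nat) (f : R -> R)
    (n : nat) : \bar R :=
  let theta := n%:R^-1 + (n%:R `^ alpha)^-1 in
  (omega (f^`(N)) theta * (theta ^+ N / N`!%:R)%:E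
   + (2 ^+ N)%:E * supnorm (f^`(N)) * ((n%:R ^+ N * N`!%:R)^-1)%:E
     * ((q + q^-1) * expR beta * expR (- (beta * n%:R `^ (1 - alpha) / 2))
        * (1 + 2 ^+ N.+1 * N`!%:R / beta ^+ N))%:E)%E.

(* For [1 <= k], bounds the absolute value of [quad_op] applied to
   [fun t => (t - x) ^+ k] at the point [x]. *)
Definition moment_bound (R : realType) (q beta : R) (n k : nat) : R :=
  2 ^+ k.-1 / n%:R ^+ k
  * (1 + (1 - expR (- beta)) / (1 + expR (- beta)) * k.+1%:R^-1
     + (q + q^-1) * (expR beta * k`!%:R / beta ^+ k)).

(* Main.v *)
Require Import Defs.
From HB Require Import structures.
From mathcomp Require Import all_boot all_order all_algebra.
From mathcomp Require Import all_classical all_reals all_analysis.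
From mathcomp Require Import measurable_realfun ring lra.

Import Order.TTheory GRing.Theory Num.Theory.
Import numFieldNormedType.Exports.

Local Open Scope ring_scope.
Local Open Scope classical_set_scope.

(** Write [u = n x - v]; the nodes [v / n + j / (n r)] lie within
    [(1 + |u|) / n] of [x], so every estimate reduces to integrals
    [\int h(u) Psi(u) du]. The density [Psi] is even, has total mass [1]
    (it has a logarithmic antiderivative), is bounded by
    [(1 - e^-beta) / (2 (1 + e^-beta))] and decays like
    [beta / 2 (q + 1/q) e^beta e^(- beta |u|)]. With
    [(1 + |u|)^k <= 2^(k-1) (1 + |u|^k)], the first bound on [|u| <= 1] and the
    second outside give the moment bounds. The Lagrange form of the Taylor
    remainder is at most [omega theta^N / N!] when [|u| < T = n^(1 - alpha)]
    (then [|t - x| <= (1 + T) / n = theta]), and at most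
    [2 ||f^(N)|| |t - x|^N / N!] always; integrating the latter over [|u| >= T]
    uses the exponential decay and produces the second term of [sigma]. *)

(** * The kernel *)

(** Mainly for the nonvanishing side conditions left by [field]: they are reduced to strict
    positivity of the factors. *)
Ltac positive := repeat first
  [ assumption | exact: ltr01 | apply/andP; split | apply: lt0r_neq0
  | apply: addr_gt0 | apply: mulr_gt0 | apply: exprn_gt0 | apply: ltW ].

Section kernel.
Context {R : realType}.
Implicit Types (q beta x u c : R).

(** The two shifted exponentials are [a * c] and [a / c], so [G] is a rational function of [a] and
    [c] with denominator [(1 + a c) (c + a)]. The estimates of [G] below are algebra on this
    form. *)
Lemma G_expR q beta x : 0 < q ->
  let a := q * expR (- (beta * x)) in let c := expR (- beta) in
  G q beta x = 2^-1 * (1 - c ^+ 2) * a / (c + (1 + c ^+ 2) * a + c * a ^+ 2).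
Proof.
move=> q0 a c; rewrite /G /nu.
have a0 : 0 < a by rewrite mulr_gt0// expR_gt0.
have c0 : 0 < c by exact: expR_gt0.
have -> : q * expR (- (beta * (x + 1))) = a * c.
  by rewrite mulrDr mulr1 opprD expRD mulrA.
have -> : q * expR (- (beta * (x - 1))) = a / c.
  by rewrite mulrDr mulrN1 opprD opprK expRD /c expRN invrK mulrA.
by field; positive.
Qed.

(** Passing from one side to the other replaces [a] by [1 / a], under which the rational function of
    [G_expR] is invariant. *)
Lemma GN q beta x : 0 < q -> G q beta (- x) = G q^-1 beta x.
Proof.
move=> q0; rewrite !G_expR ?invr_gt0//=.
set c := expR (- beta); set e := expR (- (beta * x)).
have -> : expR (- (beta * - x)) = e^-1 by rewrite /e mulrN -expRN.
have c0 : 0 < c by exact: expR_gt0.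
have e0 : 0 < e by exact: expR_gt0.
by field; positive.
Qed.

Lemma G_ge0 q beta x : 0 < q -> 0 < beta -> 0 <= G q beta x.
Proof.
move=> q0 b0; rewrite G_expR//=.
set c := expR (- beta); set e := expR (- (beta * x)).
have c0 : 0 < c by exact: expR_gt0.
have e0 : 0 < e by exact: expR_gt0.
have c1 : c <= 1 by rewrite -expR0 ler_expR oppr_le0 ltW.
apply: divr_ge0; last by positive.
apply: mulr_ge0; last by positive.
by apply: mulr_ge0; rewrite ?invr_ge0// subr_ge0 exprn_ile1 ?(ltW c0).
Qed.

(** The maximum is reached at [a = 1]: once the denominator is cleared, the defect is a nonnegative
    multiple of [c * (1 - a) ^+ 2]. *)
Lemma G_le_max q beta x : 0 < q -> 0 < beta ->
  G q beta x <= 2^-1 * ((1 - expR (- beta)) / (1 + expR (- beta))).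
Proof.
move=> q0 b0; rewrite G_expR//=.
set c := expR (- beta); set a := _ * expR _.
have c0 : 0 < c by exact: expR_gt0.
have a0 : 0 < a by rewrite mulr_gt0// expR_gt0.
have c1 : c <= 1 by rewrite -expR0 ler_expR oppr_le0 ltW.
have D0 : 0 < c + (1 + c ^+ 2) * a + c * a ^+ 2.
  by positive.
rewrite ler_pdivrMr// -subr_ge0.
suff -> : 2^-1 * ((1 - c) / (1 + c)) * (c + (1 + c ^+ 2) * a + c * a ^+ 2) -
   2^-1 * (1 - c ^+ 2) * a = 2^-1 * ((1 - c) / (1 + c)) * (c * (1 - a) ^+ 2).
  apply: mulr_ge0; last by rewrite mulr_ge0 ?sqr_ge0 ?(ltW c0).
  by rewrite mulr_ge0 ?divr_ge0 ?subr_ge0//; positive.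
by field; positive.
Qed.

(* [1 - exp (- 2 beta) <= 2 beta] bounds the numerator of [G_expR]. *)
Lemma G_le_expR q beta x : 0 < q -> 0 < beta ->
  G q beta x <= beta * (q * expR beta * expR (- (beta * x))).
Proof.
move=> q0 b0; rewrite G_expR//=.
have -> : q * expR beta * expR (- (beta * x)) =
  (q * expR (- (beta * x))) / expR (- beta) by rewrite (expRN beta) invrK; ring.
set c := expR (- beta); set a := _ * expR _.
have c0 : 0 < c by exact: expR_gt0.
have a0 : 0 < a by rewrite mulr_gt0// expR_gt0.
have c2 : 1 - c ^+ 2 <= 2 * beta.
  rewrite /c -expRM_natl; have := expR_ge1Dx (2 * - beta).
  by lra.
clearbody a c.
(* Keeping only the term [c] of the denominator produces the factor [1 / c = expR beta]. *)
have D0 : c <= c + (1 + c ^+ 2) * a + c * a ^+ 2.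
  by rewrite -addrA lerDl; positive.
rewrite ler_pdivrMr ?(lt_le_trans c0)//.
apply: (@le_trans _ _ (beta * a)).
  by rewrite ler_wpM2r ?(ltW a0)//; lra.
rewrite -mulrA ler_pM2l// -[leLHS]mulr1 -mulrA ler_pM2l//.
by rewrite mulrC ler_pdivlMr// mul1r.
Qed.

Variables (q beta : R).
Hypotheses (q0 : 0 < q) (beta0 : 0 < beta).

Lemma PsiN x : Psi q beta (- x) = Psi q beta x.
Proof. by rewrite /Psi !GN ?invr_gt0// invrK addrC. Qed.

Lemma Psi_norm x : Psi q beta `|x| = Psi q beta x.
Proof. by case: (ger0P x) => // _; exact: PsiN. Qed.

Lemma Psi_ge0 x : 0 <= Psi q beta x.
Proof. by rewrite mulr_ge0 ?addr_ge0 ?G_ge0 ?invr_gt0. Qed.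

Lemma Psi_le_max x :
  Psi q beta x <= 2^-1 * ((1 - expR (- beta)) / (1 + expR (- beta))).
Proof.
have qV0 : 0 < q^-1 by rewrite invr_gt0.
rewrite /Psi; have := G_le_max q beta x q0 beta0.
by have := G_le_max q^-1 beta x qV0 beta0; lra.
Qed.

(** [G_le_expR] is useful only to the right of the origin; evenness of [Psi] allows it to be applied
    at the absolute value. *)
Lemma Psi_le_expR x : Psi q beta x <=
  beta / 2 * (q + q^-1) * expR beta * expR (- (beta * `|x|)).
Proof.
have qV0 : 0 < q^-1 by rewrite invr_gt0.
rewrite -Psi_norm /Psi; have := G_le_expR q beta `|x| q0 beta0.
by have := G_le_expR q^-1 beta `|x| qV0 beta0; lra.
Qed.

Lemma continuous_expRMN c : continuous (fun x : R => expR (- (c * x))).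
Proof.
move=> x; apply: continuous_comp; last exact: continuous_expR.
by apply: continuousN; apply: continuousM => //; exact: cst_continuous.
Qed.

Lemma continuous_nu p : 0 < p -> continuous (nu p beta).
Proof.
move=> p0 x; have pe : p * expR (- (beta * y)) @[y --> x] -->
    p * expR (- (beta * x)).
  by apply: cvgM; [exact: cvg_cst|exact: continuous_expRMN].
apply: cvgM; first by apply: cvgB => //; exact: cvg_cst.
apply: cvgV; last by apply: cvgD => //; exact: cvg_cst.
by rewrite gt_eqF// addr_gt0// mulr_gt0// expR_gt0.
Qed.

Lemma continuous_Psi : continuous (Psi q beta).
Proof.
have cG p : 0 < p -> continuous (G p beta).
  move=> p0 x; apply: cvgM; first exact: cvg_cst.
  have cs (d : R) : nu p beta (y + d) @[y --> x] --> nu p beta (x + d).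
    apply: (@cvg_comp _ _ _ _ (nu p beta) _ (nbhs (x + d))).
      by apply: cvgD => //; exact: cvg_cst.
    exact: continuous_nu.
  by apply: cvgB; exact: cs.
move=> x; apply: cvgM; first exact: cvg_cst.
by apply: cvgD; apply: cG; rewrite ?invr_gt0.
Qed.

End kernel.

(** * Integration on the real line *)

Section derivative_rules.
Context {R : realType}.

Lemma is_derive_mulr (f g : R -> R) (x a b : R) :
  is_derive x 1 f a -> is_derive x 1 g b ->
  is_derive x 1 (fun y => f y * g y) (a * g x + f x * b).
Proof.
move=> df dg; apply: (is_derive_eq (is_deriveM df dg)).
by rewrite addrC; congr (_ + _); rewrite mulrC.
Qed.

Lemma is_derive_mull (c : R) (f : R -> R) (x a : R) :
  is_derive x 1 f a -> is_derive x 1 (fun y => c * f y) (c * a).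
Proof.
move=> df; apply: (is_derive_eq (is_derive_mulr _ _ _ _ _
  (is_derive_cst c x 1) df)).
by rewrite mul0r add0r.
Qed.

Lemma is_derive_expr (n : nat) (f : R -> R) (x a : R) :
  is_derive x 1 f a ->
  is_derive x 1 (fun y => f y ^+ n) (n%:R * f x ^+ n.-1 * a).
Proof.
move=> df; rewrite (_ : (fun y => _) = f ^+ n); first exact: is_deriveX.
by rewrite exprfctE.
Qed.

End derivative_rules.

Lemma continuous_measurable_EFin {R : realType} (D : set R) (f : R -> R) :
  continuous f -> measurable_fun D (fun u => (f u)%:E).
Proof.
move=> cf; apply/measurable_EFinP; apply: measurable_funTS.
exact: continuous_measurable_fun.
Qed.

Lemma ge0_integral_lincomb {R : realType} (a b : R) (f g : R -> R) :
  0 <= a -> 0 <= b -> (forall u, 0 <= f u) -> (forall u, 0 <= g u) ->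
  measurable_fun setT f -> measurable_fun setT g ->
  (\int[lebesgue_measure]_u (a * f u + b * g u)%:E =
   a%:E * \int[lebesgue_measure]_u (f u)%:E +
     b%:E * \int[lebesgue_measure]_u (g u)%:E)%E.
Proof.
move=> a0 b0 f0 g0 mf mg.
have mZ (c : R) (h : R -> R) : measurable_fun setT h ->
  measurable_fun setT (fun u : R => (c * h u)%:E).
  by move=> mh; apply/measurable_EFinP; exact: measurable_funM.
rewrite -!ge0_integralZl_EFin//;
  try by [move=> u _; rewrite lee_fin|exact/measurable_EFinP].
rewrite -ge0_integralD//; try exact: mZ.
- by move=> u _; rewrite lee_fin mulr_ge0.
- by move=> u _; rewrite lee_fin mulr_ge0.
Qed.

Section lebesgue_line.
Context {R : realType}.
Let mu := @lebesgue_measure R.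

(** By uniqueness it suffices to test half-open intervals: the preimage of []a, b]] is [[c - b, c -
    a[], which has the same length. *)
Lemma lebesgue_measure_subr (c : R) (A : set R) : measurable A ->
  pushforward mu ((fun v => c - v) : _ -> measurableTypeR R) A = mu A.
Proof.
move=> mA; apply/esym/lebesgue_measure_unique => //=;
  first by apply: measurable_funB.
move=> _ _ [[a b]] _ <-.
rewrite /pushforward.
have -> : (fun v => c - v) @^-1` (`]a, b]%classic : set R) =
    (`[c - b, c - a[%classic : set R).
  apply/seteqP; split=> v; rewrite /= !in_itv/= => /andP[? ?];
  by apply/andP; split; lra.
rewrite /mu !lebesgue_measure_itv/= !lte_fin ltrD2l ltrN2.
by case: ifP => // _; rewrite -!EFinD; congr EFin; ring.
Qed.

Lemma ge0_integral_subr (c : R) (h : R -> R) :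
  measurable_fun setT h -> (forall u, 0 <= h u) ->
  (\int[mu]_v (h (c - v))%:E = \int[mu]_u (h u)%:E)%E.
Proof.
move=> mh h0; have mE : measurable_fun setT (EFin \o h)
  by exact/measurable_EFinP.
pose phi : measurableTypeR R -> measurableTypeR R := fun v : R => c - v.
have mphi : measurable_fun setT phi by apply: measurable_funB.
transitivity (\int[pushforward mu phi]_u (h u)%:E)%E.
  by rewrite ge0_integral_pushforward// => u _; rewrite lee_fin.
by apply: eq_measure_integral => // A mA _; exact: lebesgue_measure_subr.
Qed.

Lemma ge0_even_integral (h : R -> R) :
  measurable_fun setT h -> (forall u, 0 <= h u) -> (forall u, h (- u) = h u) ->
  (\int[mu]_u (h u)%:E = 2%:E * \int[mu]_(u in `[0%R, +oo[) (h u)%:E)%E.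
Proof.
move=> mh h0 hN; have mE : measurable_fun setT (EFin \o h)
  by exact/measurable_EFinP.
rewrite -(setUv `[0%R, +oo[%classic) ge0_integral_setU//=; last 4 first.
- exact: measurableC.
- by rewrite setUv.
- by move=> u _; rewrite lee_fin.
- exact/disj_setPCl.
rewrite mule_natl mule2n; congr (_ + _)%E.
rewrite setCitvr integral_itv_bndo_bndc; last exact/measurable_funTS.
rewrite [RHS](@ge0_integration_by_substitution0 _ (EFin \o h))//.
by apply: eq_integral => u _ /=; rewrite hN.
Qed.

(** An antiderivative normalised to vanish at infinity contributes only its value at [a]. The
    exponential moments and the mass of [Psi] are computed this way. *)
Lemma continuous_FTC2y_cvg0 (h F : R -> R) a :
  (forall u, a <= u -> 0 <= h u) -> continuous h ->
  (forall u : R, is_derive u 1 F (h u)) -> F u @[u --> +oo%R] --> (0 : R) ->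
  (\int[mu]_(u in `[a, +oo[) (h u)%:E = (- F a)%:E)%E.
Proof.
move=> h0 ch dF F0.
rewrite (@ge0_continuous_FTC2y _ h F a 0) ?sub0e//.
- exact: continuous_subspaceT.
- apply: cvg_at_right_filter.
  exact/differentiable_continuous/derivable1_diffP/ex_derive.
- by move=> u _; rewrite derive1E; exact: derive_val.
Qed.

End lebesgue_line.

(** * Exponential moments on half-lines *)

Section exponential_moments.
Context {R : realType}.
Let mu := @lebesgue_measure R.
Implicit Types (b u : R) (k : nat).

Lemma expX_le_expR k u : 0 <= u -> u ^+ k <= k`!%:R * expR u.
Proof.
move=> u0; rewrite mulrC -ler_pdivrMr ?ltr0n ?fact_gt0//.
case: k => [|k]; first by rewrite expr0 divr1 -expR0 ler_expR.
by apply: le_trans (expR_ge1Dxn k u0); rewrite lerDr.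
Qed.

Lemma cvg_expX_expRN k : (u ^+ k * expR (- u)) @[u --> +oo%R] --> (0 : R).
Proof.
(* Using [expX_le_expR] with exponent [k.+1], one more than needed, leaves the vanishing factor
   [1 / u]. *)
apply: (@squeeze_cvgr _ _ _ _ (cst 0) (fun u => k.+1`!%:R * u^-1)).
- near=> u; have u0 : 0 < u by near: u; exact: nbhs_pinfty_gt.
  rewrite mulr_ge0 ?exprn_ge0 ?expR_ge0 ?(ltW u0)//= expRN.
  rewrite ler_pdivrMr ?expR_gt0// -mulrA [_^-1 * _]mulrC mulrA.
  by rewrite ler_pdivlMr// -exprSr expX_le_expR// ltW.
- exact: cvg_cst.
- rewrite -(mulr0 k.+1`!%:R); apply: cvgM; first exact: cvg_cst.
  by apply/gtr0_cvgV0; [exact: nbhs_pinfty_gt|exact: cvg_id].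
Unshelve. all: end_near. Qed.

Lemma is_derive_expRMN b u :
  is_derive u 1 (fun v => expR (- (b * v))) (- b * expR (- (b * u))).
Proof.
have dl : is_derive u 1 (fun v => - (b * v)) (- b).
  by apply: is_deriveN; rewrite -[X in is_derive _ _ _ X]mulr1;
    exact: is_derive_mull.
by apply: (is_derive_eq (is_derive1_comp (is_derive_expR _) dl)); rewrite mulrC.
Qed.

Lemma integral_expRMN b T : 0 < b ->
  (\int[mu]_(u in `[T, +oo[) (expR (- (b * u)))%:E =
    (b^-1 * expR (- (b * T)))%:E)%E.
Proof.
move=> b0.
have F0 : (- b^-1 * expR (- (b * u))) @[u --> +oo%R] --> (0 : R).
  rewrite -(mulr0 (- b^-1)); apply: cvgM; first exact: cvg_cst.
  apply: (@cvg_comp _ _ _ (fun v => b * v)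
    (fun v => expR (- v)) _ (pinfty_nbhs R)); last exact: cvgr_expR.
  exact: gt0_cvgMry.
have dF u : is_derive u 1
    (fun v => - b^-1 * expR (- (b * v))) (expR (- (b * u))).
  apply: (is_derive_eq (is_derive_mull _ _ _ _ (is_derive_expRMN b u))).
  by rewrite mulrA mulrNN mulVf ?mul1r// gt_eqF.
by rewrite (continuous_FTC2y_cvg0 _ _ T (fun u _ => expR_ge0 _)
  (continuous_expRMN b) dF F0) mulNr opprK.
Qed.

(* The sum over [i] telescopes under differentiation. *)
Lemma is_derive_expRN_exp_coeff b k u :
  is_derive u 1
    (fun v =>
      - (\sum_(0 <= i < k.+1) ((b * v) ^+ i / i`!%:R * expR (- (b * v)))))
    (b * ((b * u) ^+ k / k`!%:R * expR (- (b * u)))).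
Proof.
elim: k => [|k IH].
  rewrite (_ : (fun v => _) = fun v => -1 * expR (- (b * v))); last first.
    by apply/funext => v; rewrite big_nat1 expr0 divr1 mul1r mulN1r.
  apply: (is_derive_eq (is_derive_mull _ _ _ _ (is_derive_expRMN b u))).
  by rewrite expr0 divr1; ring.
have dX : is_derive u 1 (fun v => (b * v) ^+ k.+1 / k.+1`!%:R)
    (b * ((b * u) ^+ k / k`!%:R)).
  have dl : is_derive u 1 (fun v => b * v) b.
    by rewrite -[X in is_derive _ _ _ X]mulr1; exact: is_derive_mull.
  have -> : (fun v => (b * v) ^+ k.+1 / k.+1`!%:R) =
     fun v => k.+1`!%:R^-1 * (b * v) ^+ k.+1 by apply/funext => v;
       rewrite mulrC.
  apply: (is_derive_eq (is_derive_mull _ _ _ _ (is_derive_expr k.+1 _ _ _ dl))).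
  rewrite factS natrM /=.
  by field; rewrite pnatr_eq0 -lt0n fact_gt0 nat1r pnatr_eq0.
rewrite (_ : (fun v => _) = fun v =>
  - (\sum_(0 <= i < k.+1) ((b * v) ^+ i / i`!%:R * expR (- (b * v)))) +
  - ((b * v) ^+ k.+1 / k.+1`!%:R * expR (- (b * v)))); last first.
  by apply/funext => v; rewrite big_nat_recr//= opprD.
apply: (is_derive_eq (is_deriveD IH
  (is_deriveN (is_derive_mulr _ _ _ _ _ dX (is_derive_expRMN b u))))).
ring.
Qed.

Lemma integral_exprn_expRN b k : 0 < b ->
  (\int[mu]_(u in `[0%R, +oo[) (u ^+ k * expR (- (b * u)))%:E =
   (k`!%:R / b ^+ k.+1)%:E)%E.
Proof.
move=> b0; pose C := k`!%:R / b ^+ k.+1.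
(* [- F v] is the upper incomplete Gamma integral in closed form. At [0] only the term [i = 0]
   survives, so [- F 0 = C]. *)
pose F v := C *
  - (\sum_(0 <= i < k.+1) ((b * v) ^+ i / i`!%:R * expR (- (b * v)))).
have F0 : F v @[v --> +oo%R] --> (0 : R).
  rewrite -[X in _ --> X](mulr0 C); apply: cvgM; first exact: cvg_cst.
  rewrite -[X in _ --> X]oppr0; apply: cvgN.
  elim: k.+1 => [|m IH].
    by under eq_fun do rewrite big_nil; exact: cvg_cst.
  rewrite -[X in _ --> X]addr0; under eq_fun do rewrite big_nat_recr//=.
  apply: cvgD; first exact: IH.
  rewrite -[X in _ --> X](mulr0 m`!%:R^-1).
  under eq_fun do rewrite mulrAC mulrC.
  apply: cvgM; first exact: cvg_cst.
  apply: (@cvg_comp _ _ _ (fun v => b * v) (fun v => v ^+ m * expR (- v)) _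
    (pinfty_nbhs R)); last exact: cvg_expX_expRN.
  exact: gt0_cvgMry.
have dF u : is_derive u 1 F (u ^+ k * expR (- (b * u))).
  apply: (is_derive_eq (is_derive_mull _ _ _ _
    (is_derive_expRN_exp_coeff b k u))).
  rewrite /C exprMn exprS; field.
  by rewrite expf_neq0 ?(gt_eqF b0)// pnatr_eq0 -lt0n fact_gt0.
have h0 u : 0 <= u -> 0 <= u ^+ k * expR (- (b * u)).
  by move=> u0; rewrite mulr_ge0 ?exprn_ge0 ?expR_ge0.
have ch : continuous (fun u : R => u ^+ k * expR (- (b * u))).
  by move=> u; apply: cvgM; [exact: exprn_continuous|exact: continuous_expRMN].
rewrite (continuous_FTC2y_cvg0 _ _ 0 h0 ch dF F0) /F /C big_nat_recl//=.
rewrite big1_seq ?addr0; last first.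
  by move=> i _; rewrite mulr0 expr0n !mul0r.
by rewrite mulr0 oppr0 expR0 expr0 divr1 !mulr1 mulrN opprK mulr1.
Qed.

End exponential_moments.

(** * Integrals against the kernel *)

Section kernel_integrals.
Context {R : realType}.
Let mu := @lebesgue_measure R.
Variables (q beta : R).
Hypotheses (q0 : 0 < q) (beta0 : 0 < beta).

(* [x + 2 / beta * H p x] is an antiderivative of [nu p beta]; the linear terms
   cancel in [Psi]. *)
Let H (p x : R) := ln (1 + p * expR (- (beta * x))).

Let arg_gt0 (p x : R) : 0 < p -> 0 < 1 + p * expR (- (beta * x)).
Proof. by move=> p0; rewrite addr_gt0// mulr_gt0// expR_gt0. Qed.

Let is_derive_H (p d x : R) : 0 < p ->
  is_derive x 1 (fun y => H p (y + d)) (beta / 2 * (nu p beta (x + d) - 1)).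
Proof.
move=> p0; have e0 := arg_gt0 p (x + d) p0.
have dH : is_derive (x + d) 1 (H p) (beta / 2 * (nu p beta (x + d) - 1)).
  have da : is_derive (x + d) 1 (fun y => 1 + p * expR (- (beta * y)))
      (p * (- beta * expR (- (beta * (x + d))))).
    have dp := is_derive_mull p _ _ _ (is_derive_expRMN beta (x + d)).
    apply: (is_derive_eq (is_deriveD (is_derive_cst (1 : R) (x + d) 1) dp)).
    by rewrite add0r.
  pose g y := 1 + p * expR (- (beta * y)).
  apply: (is_derive_eq (@is_derive1_comp _ _ g _ _ _ (is_derive1_ln e0) da)).
  by rewrite /nu; field; rewrite gt_eqF.
have ds : is_derive x 1 (fun y => y + d) 1.
  apply: (is_derive_eq (is_deriveD (is_derive_id x 1) (is_derive_cst d x 1))).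
  by rewrite addr0.
apply: (is_derive_eq (@is_derive1_comp _ (H p) (fun y => y + d) _ _ _ dH ds)).
by rewrite mulr1.
Qed.

Let cvg_H (p d : R) : 0 < p -> H p (y + d) @[y --> +oo%R] --> (0 : R).
Proof.
move=> p0.
have e0 : expR (- (beta * (y + d))) @[y --> +oo%R] --> (0 : R).
  apply: (@cvg_comp _ _ _ (fun y => beta * (y + d)) (fun v => expR (- v)) _
    (pinfty_nbhs R)); last exact: cvgr_expR.
  by apply: gt0_cvgMry => //; exact: cvg_addrr.
have e1 : 1 + p * expR (- (beta * (y + d))) @[y --> +oo%R] --> 1 + p * 0.
  by apply: cvgD; [exact: cvg_cst|apply: cvgM => //; exact: cvg_cst].
rewrite /H -[X in _ --> X](@ln1 R) -[X in _ --> ln X]addr0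
  -[X in _ --> ln (_ + X)](mulr0 p).
apply: (cvg_comp _ (@ln R) e1); apply: continuous_ln.
by rewrite mulr0 addr0.
Qed.

(** Factor [expR (beta * x) / p] out of the argument of the logarithm. This relates the values of
    the antiderivative at [-1] and [1]. *)
Let HVN (p x : R) : 0 < p -> H p^-1 (- x) = H p x + beta * x - ln p.
Proof.
move=> p0; have a0 := arg_gt0 p x p0; have e0 := expR_gt0 (beta * x).
rewrite /H (_ : 1 + p^-1 * _ =
    (1 + p * expR (- (beta * x))) * expR (beta * x) / p).
  by rewrite ln_div ?posrE ?mulr_gt0// lnM ?posrE// expRK.
by rewrite mulrN opprK expRN; field; positive.
Qed.

Lemma integral_Psi : (\int[mu]_u (Psi q beta u)%:E = 1)%E.
Proof.
have qV0 : 0 < q^-1 by rewrite invr_gt0.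
have mP : measurable_fun setT (Psi q beta).
  by apply: continuous_measurable_fun; exact: continuous_Psi.
rewrite (ge0_even_integral _ mP (Psi_ge0 _ _ q0 beta0) (PsiN _ _ q0)).
(* The factors [1 / 2] and [1 / 4] of [Psi] and [G], divided by the [beta / 2] of [is_derive_H],
   give [1 / (4 beta)]. *)
pose F x := (4 * beta)^-1 *
  ((H q (x + 1) - H q (x + - 1)) + (H q^-1 (x + 1) - H q^-1 (x + - 1))).
have dF (x : R) : is_derive x 1 F (Psi q beta x).
  apply: (is_derive_eq (is_derive_mull _ _ _ _ (is_deriveD
    (is_deriveB (is_derive_H q 1 x q0) (is_derive_H q (-1) x q0))
    (is_deriveB (is_derive_H q^-1 1 x qV0) (is_derive_H q^-1 (-1) x qV0))))).
  by rewrite /Psi /G; field; rewrite gt_eqF.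
have F0 : F x @[x --> +oo%R] --> (0 : R).
  rewrite -[X in _ --> X](mulr0 (4 * beta)^-1); apply: cvgM;
    first exact: cvg_cst.
  rewrite -[X in _ --> X]addr0 -[X in _ --> X + X]subr0.
  by apply: cvgD; apply: cvgB; exact: cvg_H.
rewrite (continuous_FTC2y_cvg0 _ _ 0 (fun u _ => Psi_ge0 _ _ q0 beta0 u)
  (continuous_Psi _ _ q0) dF F0) /F !add0r.
(* The logarithms cancel between [q] and [1 / q], leaving [- 2 beta] in the bracket, hence
   [F 0 = - 1 / 2]; evenness doubles the half-line integral to [1]. *)
have := HVN q 1 q0; have := HVN q^-1 1 qV0; rewrite invrK lnV ?posrE// => -> ->.
rewrite -EFinM; congr EFin; field; exact: lt0r_neq0.
Qed.

Lemma integral_exprn01 k : (\int[mu]_(u in `[0%R, 1%R]) (u ^+ k)%:E =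
  (k.+1%:R^-1)%:E)%E.
Proof.
have dF (u : R) : is_derive u 1 (fun v : R => k.+1%:R^-1 * v ^+ k.+1) (u ^+ k).
  apply: (is_derive_eq (is_derive_mull _ _ _ _ (is_derive_expr k.+1 _ _ _
    (is_derive_id u 1)))).
  by rewrite mulr1 /= mulKf// pnatr_eq0.
rewrite (@continuous_FTC2 _ _ (fun v => k.+1%:R^-1 * v ^+ k.+1))//.
- by rewrite expr1n expr0n mulr0 sube0 mulr1.
- exact/continuous_subspaceT/exprn_continuous.
- have cF (u : R) :
      k.+1%:R^-1 * v ^+ k.+1 @[v --> u] --> k.+1%:R^-1 * u ^+ k.+1.
    by apply: cvgM; [exact: cvg_cst|exact: exprn_continuous].
  split; [by move=> u _; exact: ex_derive|
    exact/cvg_at_right_filter/cF|exact/cvg_at_left_filter/cF].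
- by move=> u _; rewrite derive1E; exact: derive_val.
Qed.

Lemma ge0_integral_mull (D : set R) (c : R) (f : R -> R) :
  measurable D -> 0 <= c -> (forall u, D u -> 0 <= f u) -> continuous f ->
  (\int[mu]_(u in D) (c * f u)%:E = c%:E * \int[mu]_(u in D) (f u)%:E)%E.
Proof.
move=> mD c0 f0 cf; under eq_integral do rewrite EFinM.
rewrite ge0_integralZl_EFin//.
by apply: continuous_measurable_EFin.
Qed.

Lemma measurable_norm_ge (T : R) : measurable [set u : R | T <= `|u|].
Proof.
rewrite (_ : [set u | _] = setT `&` (@Num.norm _ R) @^-1`
  (`[T, +oo[%classic : set R)).
  by apply: normr_measurable => //; exact: measurable_itv.
by rewrite setTI; apply/seteqP; split=> u /=; rewrite in_itv/= andbT.
Qed.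

Let K := beta / 2 * (q + q^-1) * expR beta.

Let K_ge0 : 0 <= K.
Proof. by rewrite /K !mulr_ge0 ?expR_ge0 ?addr_ge0 ?invr_ge0 ?ltW. Qed.

Lemma continuous_normX k : continuous (fun u : R => `|u| ^+ k).
Proof.
move=> u; apply: (@cvg_comp _ _ _ Num.norm (fun v : R => v ^+ k) _ (nbhs `|u|)).
  exact: norm_continuous.
exact: exprn_continuous.
Qed.

Lemma integral_normX_Psi k : (\int[mu]_u (`|u| ^+ k * Psi q beta u)%:E <=
  ((1 - expR (- beta)) / (1 + expR (- beta)) / k.+1%:R +
   (q + q^-1) * (expR beta * k`!%:R / beta ^+ k))%:E)%E.
Proof.
have ch : continuous (fun u : R => `|u| ^+ k * Psi q beta u).
  by move=> u; apply: cvgM; [exact: continuous_normX|exact: continuous_Psi].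
have mh (D : set R) : measurable_fun D (fun u : R => `|u| ^+ k * Psi q beta u).
  by apply: measurable_funTS; exact: continuous_measurable_fun.
have h0 (u : R) : 0 <= `|u| ^+ k * Psi q beta u.
  by rewrite mulr_ge0 ?exprn_ge0 ?Psi_ge0.
rewrite ge0_even_integral//; last by move=> u; rewrite normrN PsiN.
set m := (1 - expR (- beta)) / (1 + expR (- beta)).
have m0 : 0 <= 2^-1 * m by exact: le_trans (Psi_ge0 q beta q0 beta0 0)
  (Psi_le_max q beta q0 beta0 0).
rewrite (_ : `[0%R, +oo[%classic = `[0%R, 1%R] `|` `]1%R, +oo[); last first.
  apply/seteqP; split=> u /=; rewrite !in_itv/= !andbT;
    first by case: (leP u 1) => ? ?; [left; apply/andP|right].
  by move=> [/andP[]//|u1]; lra.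
rewrite ge0_integral_setU//=; first last.
- apply/disj_setPS => u /= []; rewrite !in_itv/= andbT => /andP[_ u1].
  by rewrite ltNge u1.
- by move=> u _; rewrite lee_fin.
- exact: continuous_measurable_EFin.
have I1 : (\int[mu]_(u in `[0%R, 1%R]) (`|u| ^+ k * Psi q beta u)%:E <=
  (2^-1 * m / k.+1%:R)%:E)%E.
  rewrite EFinM -integral_exprn01 -ge0_integral_mull//; first last.
  - exact: exprn_continuous.
  - by move=> u /=; rewrite in_itv/= => /andP[? _]; exact: exprn_ge0.
  apply: ge0_le_integral => //.
  - by move=> u _; rewrite lee_fin.
  - exact: continuous_measurable_EFin.
  - apply: continuous_measurable_EFin => u.
    by apply: cvgM; [exact: cvg_cst|exact: exprn_continuous].
  - move=> u /=; rewrite in_itv/= => /andP[u0 _];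
      rewrite lee_fin mulrC ger0_norm//.
    by rewrite ler_wpM2r ?exprn_ge0// Psi_le_max.
have cg : continuous (fun u : R => u ^+ k * expR (- (beta * u))).
  by move=> u; apply: cvgM; [exact: exprn_continuous|exact: continuous_expRMN].
have cKg : continuous (fun u : R => K * (u ^+ k * expR (- (beta * u)))).
  by move=> u; apply: cvgM; [exact: cvg_cst|exact: cg].
have I2 : (\int[mu]_(u in `]1%R, +oo[) (`|u| ^+ k * Psi q beta u)%:E <=
  (K * (k`!%:R / beta ^+ k.+1))%:E)%E.
  rewrite EFinM -integral_exprn_expRN// -ge0_integral_mull//; last first.
    by move=> u /=; rewrite in_itv/= andbT => u0;
      rewrite mulr_ge0 ?exprn_ge0 ?expR_ge0.
  apply: (@le_trans _ _ (\int[mu]_(u in `]1%R, +oo[)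
      (K * (u ^+ k * expR (- (beta * u))))%:E)%E).
    apply: ge0_le_integral => //.
    - by move=> u _; rewrite lee_fin.
    - exact: continuous_measurable_EFin.
    - exact: continuous_measurable_EFin.
    - move=> u /=; rewrite in_itv/= andbT => u1; have u0 : 0 <= u by lra.
      rewrite lee_fin ger0_norm// [leRHS]mulrCA ler_wpM2l ?exprn_ge0//.
      by have := Psi_le_expR q beta q0 beta0 u; rewrite ger0_norm.
  (* The majorant is integrated over the whole half-line from [0], where its integral is a complete
     Gamma integral. *)
  apply: ge0_subset_integral => //.
  - exact: continuous_measurable_EFin.
  - move=> u /=; rewrite in_itv/= andbT => u0; rewrite lee_fin.
    by apply: mulr_ge0 => //; rewrite mulr_ge0 ?exprn_ge0 ?expR_ge0.
  - by move=> u /=; rewrite !in_itv/= !andbT => ?; lra.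
(* The factor [2] from evenness cancels the [1 / 2] in both bounds, and the [beta] in [K] lowers
   [beta ^+ k.+1] to [beta ^+ k]. *)
apply: le_trans (lee_wpmul2l _ (leeD I1 I2)) _ => //; rewrite ?lee_fin//.
rewrite /K le_eqVlt; apply/orP; left; apply/eqP.
by rewrite exprS; field; rewrite expf_neq0 ?gt_eqF//= addr_gt0 ?expR_gt0.
Qed.

(** Half of the exponential decay absorbs the power [|u| ^+ k]; the other half is integrated over
    the tail, whence the rate [beta * T / 2]. *)
Lemma integral_normX_Psi_tail k T : 0 < T ->
  (\int[mu]_u (\1_[set u : R | (T <= `|u|)%R] u *
     ((1 + `|u| ^+ k) * Psi q beta u))%:E <=
  ((q + q^-1) * expR beta * expR (- (beta * T / 2)) *
    (1 + 2 ^+ k.+1 * k`!%:R / beta ^+ k))%:E)%E.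
Proof.
move=> T0; set A := [set u : R | _];
  have mA : measurable A := measurable_norm_ge T.
have ch : continuous (fun u : R => (1 + `|u| ^+ k) * Psi q beta u).
  move=> u; apply: cvgM; last exact: continuous_Psi.
  by apply: cvgD; [exact: cvg_cst|exact: continuous_normX].
have h0 (u : R) : 0 <= (1 + `|u| ^+ k) * Psi q beta u.
  by rewrite mulr_ge0 ?addr_ge0 ?exprn_ge0 ?Psi_ge0.
rewrite ge0_even_integral//; first last.
- move=> u; rewrite normrN PsiN// !indicE (_ : (- u \in A) = (u \in A))//.
  by apply/idP/idP; rewrite !inE /A/= normrN.
- by move=> u; rewrite mulr_ge0.
- by apply: measurable_funM; [exact: measurable_indic|exact:
    continuous_measurable_fun].
(* [expX_le_expR] at [beta / 2 * u] gives [u ^+ k <= C * expR (beta / 2 * u)]. *)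
pose C := k`!%:R * 2 ^+ k / beta ^+ k.
have C0 : 0 <= C by rewrite /C !mulr_ge0 ?invr_ge0 ?exprn_ge0// ltW.
have bound u : T <= u -> (1 + `|u| ^+ k) * Psi q beta u <=
    K * expR (- (beta * u)) + K * C * expR (- (beta / 2 * u)).
  move=> Tu; have u0 : 0 <= u by lra.
  rewrite ger0_norm// -mulrA -mulrDr.
  have := Psi_le_expR q beta q0 beta0 u; rewrite ger0_norm// -/K => hP.
  apply: le_trans (ler_wpM2l _ hP) _; first by rewrite addr_ge0 ?exprn_ge0.
  rewrite mulrCA ler_wpM2l// mulrDl mul1r lerD2l.
  have -> : expR (- (beta * u)) =
      expR (- (beta / 2 * u)) * expR (- (beta / 2 * u)).
    by rewrite -expRD; congr expR; field.
  rewrite mulrA ler_wpM2r ?expR_ge0// expRN ler_pdivrMr ?expR_gt0//.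
  have b2 : 0 <= beta / 2 * u by rewrite mulr_ge0 ?divr_ge0 ?(ltW beta0).
  have -> : u ^+ k = 2 ^+ k / beta ^+ k * (beta / 2 * u) ^+ k.
    by rewrite !exprMn exprVn; field; rewrite !expf_neq0// gt_eqF.
  have -> : C * expR (beta / 2 * u) =
    2 ^+ k / beta ^+ k * (k`!%:R * expR (beta / 2 * u)).
    by rewrite /C; ring.
  by rewrite ler_wpM2l ?expX_le_expR// divr_ge0 ?exprn_ge0// ltW.
have ce b : continuous (fun u : R => expR (- (b * u))) := continuous_expRMN b.
have cKe : continuous (fun u : R => K * expR (- (beta * u))).
  by move=> u; apply: cvgM; [exact: cvg_cst|exact: ce].
have cCe : continuous (fun u : R => K * C * expR (- (beta / 2 * u))).
  by move=> u; apply: cvgM; [exact: cvg_cst|exact: ce].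
have KC0 : 0 <= K * C by exact: mulr_ge0.
have -> : (\int[mu]_(u in `[0%R, +oo[)
      (\1_A u * ((1 + `|u| ^+ k) * Psi q beta u))%:E =
    \int[mu]_(u in `[T, +oo[) ((1 + `|u| ^+ k) * Psi q beta u)%:E)%E.
  rewrite (_ : `[T, +oo[%classic = `[0%R, +oo[ `&` A); last first.
    apply/seteqP; split=> u; rewrite /= !in_itv/= !andbT.
      by move=> Tu; split; rewrite /A/= ?ger0_norm//; lra.
    by move=> [u0]; rewrite /A/= ger0_norm.
  rewrite integral_mkcondr; apply: eq_integral => u _.
  by rewrite patchE indicE; case: ifP => _; rewrite ?mul1r ?mul0r.
have I : (\int[mu]_(u in `[T, +oo[) ((1 + `|u| ^+ k) * Psi q beta u)%:E <=
    (K * (beta^-1 * expR (- (beta * T))))%:E +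
    (K * C * ((beta / 2)^-1 * expR (- (beta / 2 * T))))%:E)%E.
  rewrite [X in (_ <= X + _)%E]EFinM [X in (_ <= _ + X)%E]EFinM.
  rewrite -!integral_expRMN ?divr_gt0// -!ge0_integral_mull//;
    try by move=> u _; exact: expR_ge0.
  rewrite -ge0_integralD//; first last.
  - exact: continuous_measurable_EFin.
  - by move=> u _; rewrite lee_fin mulr_ge0 ?expR_ge0.
  - exact: continuous_measurable_EFin.
  - by move=> u _; rewrite lee_fin mulr_ge0 ?expR_ge0.
  apply: ge0_le_integral => //.
  - by move=> u _; rewrite lee_fin.
  - exact: continuous_measurable_EFin.
  - by apply: emeasurable_funD; apply: continuous_measurable_EFin.
  - by move=> u /=; rewrite in_itv/= andbT -EFinD lee_fin => /bound.
apply: le_trans (lee_wpmul2l _ I) _; first by rewrite lee_fin.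
rewrite -EFinD -EFinM lee_fin.
have -> : expR (- (beta / 2 * T)) = expR (- (beta * T / 2)) by congr expR;
  field.
set E := expR (- (beta * T / 2)).
(* The constant summand decays at the full rate; it is weakened to the common factor [E]. *)
have hE : expR (- (beta * T)) <= E.
  by rewrite ler_expR; have : 0 < beta * T by [exact: mulr_gt0]; lra.
have -> : 2 * (K * (beta^-1 * expR (- (beta * T))) +
  K * C * ((beta / 2)^-1 * E)) =
    (q + q^-1) * expR beta * (expR (- (beta * T)) +
      E * (2 ^+ k.+1 * k`!%:R / beta ^+ k)).
  by rewrite /K /C exprS; field; rewrite expf_neq0 ?gt_eqF.
rewrite -[leRHS]mulrA ler_wpM2l ?mulr_ge0 ?expR_ge0 ?addr_ge0 ?invr_ge0
  ?(ltW q0)//.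
by rewrite mulrDr mulr1 lerD2r.
Qed.

End kernel_integrals.

(** * Taylor's formula *)

Section taylor.
Context {R : realType}.
Implicit Types f : R -> R.

Lemma is_derive_derive1n f k (x : R) :
  derivable (derive1n k f) x 1 -> is_derive x 1 (derive1n k f)
    (derive1n k.+1 f x).
Proof. by move=> df; apply: DeriveDef => //; rewrite derive1nS derive1E. Qed.

(* Differentiating the Taylor polynomial in its base point telescopes. *)
Lemma is_derive_taylor_base f M (t s : R) :
  (forall k, (k < M.+1)%N -> derivable (derive1n k f) s 1) ->
  is_derive s 1
    (fun y => \sum_(0 <= k < M.+1) derive1n k f y / k`!%:R * (t - y) ^+ k)
    (derive1n M.+1 f s / M`!%:R * (t - s) ^+ M).
Proof.
elim: M => [|M IH] df.
  rewrite (_ : (fun y => _) = (derive1n 0 f)); last first.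
    by apply/funext => y; rewrite big_nat1 expr0 mulr1 divr1.
  by rewrite expr0 mulr1 divr1; apply: is_derive_derive1n; exact: df.
rewrite (_ : (fun y => _) =
    (fun y => \sum_(0 <= k < M.+1) derive1n k f y / k`!%:R * (t - y) ^+ k) \+
    (fun y => (M.+1`!%:R^-1 * derive1n M.+1 f y) * (t - y) ^+ M.+1));
      last first.
  by apply/funext => y; rewrite big_nat_recr//= [_^-1 * _]mulrC.
have dts : is_derive s 1 (fun y => t - y) (- 1).
  apply: (is_derive_eq (is_deriveB (is_derive_cst t s 1) (is_derive_id s 1))).
  by rewrite sub0r.
have dM := is_derive_mull M.+1`!%:R^-1 _ _ _ (is_derive_derive1n _ _ _ (df M.+1
  (ltnSn _))).
apply: (is_derive_eq (is_deriveD (IH (fun k h => df k (ltnW h)))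
  (is_derive_mulr _ _ _ _ _ dM (is_derive_expr M.+1 _ _ _ dts)))).
rewrite /= factS natrM; field.
by rewrite pnatr_eq0 -lt0n fact_gt0 nat1r pnatr_eq0.
Qed.

(** Rolle's theorem for either order of [x] and [t]. The clause [c != t] permits cancelling a power
    of [t - c] in [taylor_lagrange]. *)
Lemma Rolle_between (phi dphi : R -> R) (x t : R) : x != t ->
  (forall s : R, is_derive s 1 phi (dphi s)) -> phi x = phi t ->
  exists c, [/\ c != t, `|c - x| <= `|t - x| & dphi c = 0].
Proof.
move=> xt dp pxt.
have dphi' (s : R) : derivable phi s 1 by have := dp s => ?; exact: ex_derive.
have cphi : continuous phi.
  by move=> s; exact/differentiable_continuous/derivable1_diffP.
have d0 (c : R) : is_derive c 1 phi 0 -> dphi c = 0.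
  by move=> dc; rewrite -(@derive_val _ _ _ _ _ _ _ (dp c)) derive_val.
case/lt_total/orP: xt => [lt|lt].
- have [c] := Rolle lt (fun s _ => dphi' s) (continuous_subspaceT cphi) pxt.
  rewrite in_itv/= => /andP[xc ct] /d0 dc; exists c; split => //;
    first by rewrite lt_eqF.
  by rewrite !ger0_norm; lra.
- have [c] := Rolle lt (fun s _ => dphi' s) (continuous_subspaceT cphi)
    (esym pxt).
  rewrite in_itv/= => /andP[tc cx] /d0 dc; exists c; split => //;
    first by rewrite gt_eqF.
  by rewrite !ler0_norm; lra.
Qed.

(** Move the base point [y] of the Taylor polynomial and add [K * (t - y) ^+ N], with [K] chosen so
    that the values at [y = x] and [y = t] agree. Rolle gives a point where the telescoped
    derivative vanishes, which identifies [K] with the Lagrange coefficient. *)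
Lemma taylor_lagrange f N (x t : R) : (0 < N)%N ->
  (forall k, (k < N)%N -> forall y : R, derivable (derive1n k f) y 1) ->
  exists2 xi, `|xi - x| <= `|t - x| &
    f t = \sum_(0 <= k < N) derive1n k f x / k`!%:R * (t - x) ^+ k +
          derive1n N f xi / N`!%:R * (t - x) ^+ N.
Proof.
case: N => // M _ df.
have base y : \sum_(0 <= k < M.+1) derive1n k f y / k`!%:R * (y - y) ^+ k = f y.
  rewrite big_nat_recl// big1_seq ?addr0; first by rewrite expr0 mulr1 divr1.
  by move=> k _; rewrite subrr expr0n mulr0.
have [<-|xt] := eqVneq x t.
  by exists x => //; rewrite base subrr expr0n mulr0 addr0.
pose K := (f t - \sum_(0 <= k < M.+1) derive1n k f x / k`!%:R *
  (t - x) ^+ k) / (t - x) ^+ M.+1.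
pose phi y := \sum_(0 <= k < M.+1) derive1n k f y / k`!%:R * (t - y) ^+ k +
  K * (t - y) ^+ M.+1.
have tx0 : (t - x) ^+ M.+1 != 0 by rewrite expf_neq0// subr_eq0 eq_sym.
have dphi (s : R) : is_derive s 1 phi
    (derive1n M.+1 f s / M`!%:R * (t - s) ^+ M - K * M.+1%:R * (t - s) ^+ M).
  have dts : is_derive s 1 (fun y => t - y) (- 1).
    apply: (is_derive_eq (is_deriveB (is_derive_cst t s 1) (is_derive_id s 1))).
    by rewrite sub0r.
  have d1 := is_derive_taylor_base f M t s (fun k h => df k h s).
  apply: (is_derive_eq (is_deriveD d1 (is_derive_mull K _ _ _
    (is_derive_expr M.+1 _ _ _ dts)))).
  by rewrite /=; ring.
have phixt : phi x = phi t.
  by rewrite /phi /K base subrr expr0n mulr0 addr0 divfK// addrC subrK.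
have [c [ct cx /eqP]] := Rolle_between _ _ _ _ xt dphi phixt.
have tc0 : (t - c) ^+ M != 0 by rewrite expf_neq0// subr_eq0 eq_sym.
rewrite -mulrBl mulf_eq0 (negPf tc0) orbF subr_eq0 => /eqP Kc.
exists c => //.
have -> : derive1n M.+1 f c / M.+1`!%:R = K.
  apply: (@mulIf _ M.+1%:R); first by rewrite pnatr_eq0.
  rewrite -Kc factS natrM; field.
  by rewrite pnatr_eq0 -lt0n fact_gt0 nat1r pnatr_eq0.
by rewrite /K divfK// addrC subrK.
Qed.

End taylor.

(** * The quadrature operator *)

(** Induction on [k]; the step amounts to [1 - a] and [1 - a ^+ k] having the same sign. *)
Lemma exprD1_le (R : realFieldType) (a : R) k : 0 <= a -> (0 < k)%N ->
  (1 + a) ^+ k <= 2 ^+ k.-1 * (1 + a ^+ k).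
Proof.
move=> a0; case: k => // k _; elim: k => [|k IH] /=;
  first by rewrite expr0 mul1r !expr1.
have cross : 0 <= (1 - a) * (1 - a ^+ k.+1).
  have [a1|/ltW a1] := leP a 1.
    by rewrite mulr_ge0 ?subr_ge0// exprn_ile1.
  by rewrite mulr_le0 ?subr_le0// exprn_ege1.
rewrite exprS mulrC; apply: le_trans (ler_wpM2r _ IH) _;
  first by rewrite addr_ge0.
rewrite /= [2 ^+ k.+1]exprSr -!mulrA ler_wpM2l ?exprn_ge0//.
by rewrite [a ^+ k.+2]exprS; lra.
Qed.

Section quadrature.
Context {R : realType}.
Let mu := @lebesgue_measure R.
Variables (q beta : R) (n r : nat) (w : nat -> R).
Hypotheses (q0 : 0 < q) (beta0 : 0 < beta) (n0 : (0 < n)%N) (r0 : (0 < r)%N).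
Hypothesis w_ge0 : forall j, (1 <= j <= r)%N -> 0 <= w j.
Hypothesis w_sum1 : \sum_(1 <= j < r.+1) w j = 1.

Let nR0 : 0 < n%:R :> R. Proof. by rewrite ltr0n. Qed.

(** After scaling by [n] the displacement is [j / r - (n x - v)], and [j / r <= 1]. *)
Lemma quad_node_dist (j : nat) (x v : R) : (1 <= j <= r)%N ->
  `|v / n%:R + j%:R / (n * r)%:R - x| <= (1 + `|n%:R * x - v|) / n%:R.
Proof.
move=> /andP[_ jr]; have rR0 : 0 < r%:R :> R by rewrite ltr0n.
have -> : v / n%:R + j%:R / (n * r)%:R - x =
  (j%:R / r%:R - (n%:R * x - v)) / n%:R.
  by rewrite natrM; field; rewrite !gt_eqF.
have nV0 : 0 <= n%:R^-1 :> R by rewrite invr_ge0 ltW.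
rewrite normrM (ger0_norm nV0) ler_wpM2r//.
apply: le_trans (ler_normB _ _) _; rewrite lerD2r ger0_norm ?divr_ge0//.
by rewrite ler_pdivrMr// mul1r ler_nat.
Qed.

Lemma measurable_quad_integrand (g : R -> R) (x : R) : measurable_fun setT g ->
  measurable_fun setT (quad_integrand q beta r w n g x).
Proof.
move=> mg; apply: measurable_funM; last first.
  apply: (measurableT_comp (continuous_measurable_fun
    (continuous_Psi q beta q0))).
  by apply: measurable_funB.
apply: measurable_sum => j; apply: measurable_funM => //.
apply: (measurableT_comp mg).
by apply: measurable_funD => //; apply: measurable_funM.
Qed.

(** The weights form a convex combination, so a bound valid at every node passes to the integrand;
    the substitution [u = n x - v] then compares with the integral of [h * Psi]. Convergence and the
    bound come from the same estimate. *)
Lemma quad_op_dominated (g h : R -> R) (x B : R) :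
  measurable_fun setT g -> measurable_fun setT h ->
  (forall t u : R, `|t - x| <= (1 + `|u|) / n%:R -> `|g t| <= h u) ->
  (\int[mu]_u (h u * Psi q beta u)%:E <= B%:E)%E ->
  quad_converges q beta r w n g x /\ `|quad_op q beta r w n g x| <= B.
Proof.
move=> mg mh gh hB; set F := quad_integrand q beta r w n g x.
have mF : measurable_fun setT F := measurable_quad_integrand g x mg.
have h0 u : 0 <= h u.
  apply: le_trans (normr_ge0 (g x)) (gh x u _).
  by rewrite subrr normr0 divr_ge0 ?addr_ge0 ?(ltW nR0).
have mhP : measurable_fun setT (fun u : R => h u * Psi q beta u).
  by apply: measurable_funM => //; by apply: continuous_measurable_fun;
    exact: continuous_Psi.
have hP0 u : 0 <= h u * Psi q beta u by rewrite mulr_ge0// Psi_ge0.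
have Fle v : `|F v| <= h (n%:R * x - v) * Psi q beta (n%:R * x - v).
  rewrite /F /quad_integrand normrM (ger0_norm (Psi_ge0 _ _ q0 beta0 _)).
  apply: ler_wpM2r; first exact: Psi_ge0.
  apply: le_trans (ler_norm_sum _ _ _) _.
  rewrite -[leRHS]mul1r -[X in _ <= X * _]w_sum1 mulr_suml;
    apply: ler_sum_nat => j jr.
  rewrite normrM ger0_norm ?w_ge0// ler_wpM2l ?w_ge0//.
  by apply: gh; exact: quad_node_dist.
have intF : (\int[mu]_v `|(F v)%:E| <= B%:E)%E.
  apply: le_trans hB; rewrite -(ge0_integral_subr (n%:R * x) _ mhP hP0).
  apply: ge0_le_integral => //.
  - exact/measurableT_comp/measurable_EFinP.
  - apply/measurable_EFinP; apply: (measurableT_comp mhP).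
    by apply: measurable_funB.
  - by move=> v _; rewrite lee_fin; exact: Fle.
have iF : mu.-integrable setT (EFin \o F).
  apply/integrableP; split; first exact/measurable_EFinP.
  by apply: le_lt_trans intF _; rewrite ltry.
split => //; rewrite -lee_fin /quad_op EFin_normr_Rintegral//.
by apply: le_trans (le_abse_integral _ _ _) intF => //; exact/measurable_EFinP.
Qed.

(** Dominate by [2 ^+ k.-1 / n ^+ k * (1 + |u| ^+ k)]: the mass of [Psi] gives the leading [1] of
    [moment_bound], and [integral_normX_Psi] the rest. *)
Lemma quad_op_power (x : R) k : (0 < k)%N ->
  quad_converges q beta r w n (fun t => (t - x) ^+ k) x /\
  `|quad_op q beta r w n (fun t => (t - x) ^+ k) x| <= moment_bound q beta n k.
Proof.
move=> k0; pose c : R := 2 ^+ k.-1 / n%:R ^+ k.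
have c0 : 0 <= c by rewrite divr_ge0 ?exprn_ge0 ?(ltW nR0).
apply: (quad_op_dominated _ (fun u => c * (1 + `|u| ^+ k))).
- apply: continuous_measurable_fun => t;
    apply: (@cvg_comp _ _ _ (fun t => t - x) (fun v : R =>
      v ^+ k) _ (nbhs (t - x))).
    by apply: cvgB => //; exact: cvg_cst.
  exact: exprn_continuous.
- apply: measurable_funM => //; apply: measurable_funD => //.
  by apply: continuous_measurable_fun; exact: continuous_normX.
- move=> t u tu; rewrite normrX; apply: le_trans (_ : _ <=
    ((1 + `|u|) / n%:R) ^+ k) _.
    by rewrite lerXn2r// nnegrE ?divr_ge0 ?addr_ge0 ?(ltW nR0).
  rewrite exprMn exprVn /c mulrAC ler_wpM2r ?invr_ge0 ?exprn_ge0 ?(ltW nR0)//.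
  by rewrite exprD1_le.
under eq_integral do rewrite -mulrA mulrDl mul1r mulrDr.
have cP := continuous_Psi q beta q0.
have mP : measurable_fun setT (Psi q beta) by exact: continuous_measurable_fun.
have mkP : measurable_fun setT (fun u : R => `|u| ^+ k * Psi q beta u).
  apply: continuous_measurable_fun => u.
  by apply: cvgM; [exact: continuous_normX|exact: cP].
have P0 (u : R) : 0 <= Psi q beta u by exact: Psi_ge0.
have kP0 (u : R) : 0 <= `|u| ^+ k * Psi q beta u.
  by apply: mulr_ge0 => //; exact: exprn_ge0.
rewrite ge0_integral_lincomb// integral_Psi// /moment_bound -addrA -/c.
rewrite mulrDr mulr1 EFinD mule1 leeD2l// [X in (_ <=
  X)%E]EFinM lee_wpmul2l ?lee_fin//.
exact: integral_normX_Psi.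
Qed.

(** The bound [A] covers [|u| < T]; the growth bound enters only through the indicator of
    [T <= |u|], where the tail estimate makes it exponentially small. *)
Lemma quad_op_remainder (g : R -> R) (x T A D : R) N : (0 < N)%N -> 0 < T ->
  measurable_fun setT g -> 0 <= A -> 0 <= D ->
  (forall t, `|t - x| <= (1 + T) / n%:R -> `|g t| <= A) ->
  (forall t, `|g t| <= D * `|t - x| ^+ N) ->
  quad_converges q beta r w n g x /\
  `|quad_op q beta r w n g x| <= A + D * (2 ^+ N.-1 / n%:R ^+ N) *
    ((q + q^-1) * expR beta * expR (- (beta * T / 2)) *
      (1 + 2 ^+ N.+1 * N`!%:R / beta ^+ N)).
Proof.
move=> N0 T0 mg A0 D0 gA gD; pose c : R := D * (2 ^+ N.-1 / n%:R ^+ N).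
have c0 : 0 <= c by rewrite mulr_ge0 ?divr_ge0 ?exprn_ge0 ?(ltW nR0).
pose I (u : R) : R := \1_[set u : R | T <= `|u|] u.
have mI : measurable_fun setT I by apply: measurable_indic;
  exact: measurable_norm_ge.
have mX : measurable_fun setT (fun u : R => 1 + `|u| ^+ N).
  apply: measurable_funD => //.
  by apply: continuous_measurable_fun; exact: continuous_normX.
apply: (quad_op_dominated _ (fun u => A + c * (I u * (1 + `|u| ^+ N)))) => //.
- apply: measurable_funD => //; apply: measurable_funM => //.
  exact: measurable_funM.
- move=> t u tu; have [uT|Tu] := ltP `|u| T.
    apply: (@le_trans _ _ A); last first.
      by rewrite lerDl !mulr_ge0 ?addr_ge0 ?exprn_ge0.
    apply: gA; apply: le_trans tu _.
    by rewrite ler_pM2r ?invr_gt0// lerD2l ltW.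
  rewrite /I indicE mem_set// mul1r; apply: le_trans (gD t) _.
  apply: (@le_trans _ _ (c * (1 + `|u| ^+ N))); last by rewrite lerDr.
  rewrite /c -mulrA ler_wpM2l//.
  apply: le_trans (_ : _ <= ((1 + `|u|) / n%:R) ^+ N) _.
    by rewrite lerXn2r// nnegrE ?divr_ge0 ?addr_ge0 ?(ltW nR0).
  rewrite exprMn exprVn mulrAC ler_wpM2r ?invr_ge0 ?exprn_ge0 ?(ltW nR0)//.
  by rewrite exprD1_le.
have cP := continuous_Psi q beta q0.
have P0 (u : R) : 0 <= Psi q beta u by exact: Psi_ge0.
have mP : measurable_fun setT (Psi q beta) by exact: continuous_measurable_fun.
have mH : measurable_fun setT (fun u : R =>
  I u * ((1 + `|u| ^+ N) * Psi q beta u)).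
  by apply: measurable_funM => //; exact: measurable_funM.
have H0 (u : R) : 0 <= I u * ((1 + `|u| ^+ N) * Psi q beta u).
  by apply: mulr_ge0 => //; apply: mulr_ge0 => //; rewrite addr_ge0 ?exprn_ge0.
under eq_integral do rewrite mulrDl -2!mulrA.
rewrite ge0_integral_lincomb// integral_Psi// mule1 EFinD leeD2l// [X in (_ <=
  X)%E]EFinM.
rewrite lee_wpmul2l ?lee_fin//; exact: integral_normX_Psi_tail.
Qed.

(** The zeroth moment, which complements [quad_op_power]; it turns the constant Taylor term into
    [f x]. *)
Lemma quad_op_cst1 (x : R) :
  quad_converges q beta r w n (fun=> 1) x /\
    quad_op q beta r w n (fun=> 1) x = 1.
Proof.
have E : quad_integrand q beta r w n (fun=> 1) x =
  fun v => Psi q beta (n%:R * x - v).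
  apply/funext => v; rewrite /quad_integrand.
  by under eq_bigr do rewrite mulr1; rewrite w_sum1 mul1r.
have mP : measurable_fun setT (Psi q beta).
  by apply: continuous_measurable_fun; exact: continuous_Psi.
have IP := ge0_integral_subr (n%:R * x) _ mP (Psi_ge0 _ _ q0 beta0).
rewrite integral_Psi// in IP.
split; last by rewrite /quad_op E /Rintegral IP.
apply/integrableP; split.
  by apply/measurable_EFinP; apply: measurable_quad_integrand.
rewrite E; under eq_integral do rewrite /= ger0_norm ?Psi_ge0//.
by rewrite IP ltry.
Qed.

Lemma quad_op_linear (c : R) (f g : R -> R) (x : R) :
  quad_converges q beta r w n f x -> quad_converges q beta r w n g x ->
  quad_converges q beta r w n (fun t => c * f t + g t) x /\
  quad_op q beta r w n (fun t => c * f t + g t) x =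
    c * quad_op q beta r w n f x + quad_op q beta r w n g x.
Proof.
move=> If Ig.
have E : quad_integrand q beta r w n (fun t => c * f t + g t) x =
    fun v => c * quad_integrand q beta r w n f x v +
      quad_integrand q beta r w n g x v.
  apply/funext => v; rewrite /quad_integrand mulrA -mulrDl mulr_sumr
    -big_split/=.
  by congr (_ * _); apply: eq_bigr => j _; rewrite mulrDr mulrCA.
have Icf : mu.-integrable setT
    (fun v => (c * quad_integrand q beta r w n f x v)%:E).
  by under eq_fun do rewrite EFinM; exact: integrableZl.
split.
  by rewrite /quad_converges E; under eq_fun do rewrite EFinD;
    exact: integrableD.
by rewrite /quad_op E RintegralD// RintegralZl.
Qed.

(** The extra summand [g] holds the Taylor remainder; generalising over it lets the induction absorb
    the last term of the sum. *)
Lemma quad_op_sum (c : nat -> R) (F : nat -> R -> R) (x : R) m :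
  (forall k, (k < m)%N -> quad_converges q beta r w n (F k) x) ->
  forall g, quad_converges q beta r w n g x ->
  quad_converges q beta r w n
    (fun t => \sum_(0 <= k < m) c k * F k t + g t) x /\
  quad_op q beta r w n (fun t => \sum_(0 <= k < m) c k * F k t + g t) x =
    \sum_(0 <= k < m) c k * quad_op q beta r w n (F k) x +
      quad_op q beta r w n g x.
Proof.
elim: m => [|m IH] IF g Ig.
  by under eq_fun do rewrite big_nil add0r; rewrite big_nil add0r.
have [I1 E1] := quad_op_linear (c m) _ _ _ (IF m (ltnSn m)) Ig.
under eq_fun do rewrite big_nat_recr//= -addrA.
rewrite big_nat_recr//= -addrA -E1.
by apply: IH => // k km; apply: IF; exact: ltnW.
Qed.

End quadrature.

(** * Sup-norm and modulus of continuity of bounded functions *)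

Lemma CB_bound {R : realType} (g : R -> R) : CB g ->
  exists C : R, forall y, `|g y| <= C.
Proof.
(* Boundedness only provides the bounds strictly above [M], hence the [+ 1]. *)
move=> [_ [M [_ hM]]]; exists (`|M| + 1) => y.
by apply: hM => //; rewrite ltr_pwDr// ler_norm.
Qed.

(** Replaces an extended-real supremum by a real number, so that [supnorm] and [omega] can enter
    real estimates. Nonemptiness of [P] rules out the value [-oo]. *)
Lemma ereal_sup_EFin_bounded {R : realType} {T : Type} (P : set T)
    (F : T -> R) (B : R) :
  P !=set0 -> (forall p, P p -> 0 <= F p <= B) ->
  exists s : R, [/\ ereal_sup [set (F p)%:E | p in P] = s%:E, 0 <= s <= B &
    forall p, P p -> F p <= s].
Proof.
move=> [p0 Pp0] FB; set S := [set _ | _ in _].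
have ub p : P p -> ((F p)%:E <= ereal_sup S)%E.
  by move=> Pp; apply: ereal_sup_ubound; exists p.
have leB : (ereal_sup S <= B%:E)%E.
  by apply: ge_ereal_sup => _ [p Pp <-]; rewrite lee_fin; case/andP: (FB p Pp).
have ge0 : (0 <= ereal_sup S)%E.
  by apply: le_trans (ub p0 Pp0); rewrite lee_fin; case/andP: (FB p0 Pp0).
have fin : ereal_sup S \is a fin_num.
  by rewrite ge0_fin_numE// (le_lt_trans leB)// ltry.
exists (fine (ereal_sup S)); split; first by rewrite fineK.
- by rewrite -!lee_fin fineK// ge0.
- by move=> p Pp; rewrite -lee_fin fineK// ub.
Qed.

Section moduli.
Context {R : realType} (g : R -> R) (B : R).
Hypothesis gB : forall y, `|g y| <= B.

Lemma supnorm_bounded : exists2 M : R, supnorm g = M%:E & forall y, `|g y| <= M.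
Proof.
rewrite /supnorm; have [|y _|M [-> _ hM]] :=
  @ereal_sup_EFin_bounded _ _ setT (fun y => `|g y|) B.
- by exists 0.
- by rewrite normr_ge0 gB.
- by exists M => // y; exact: hM.
Qed.

(** The bound [2 * B] is uniform in [theta]; [cvg_sigma] relies on this. *)
Lemma omega_bounded (theta : R) : 0 <= theta -> exists W : R,
  [/\ omega g theta = W%:E, 0 <= W <= 2 * B &
    forall y z, `|y - z| <= theta -> `|g y - g z| <= W].
Proof.
move=> th0; rewrite /omega; have [||W [-> WB hW]] := @ereal_sup_EFin_bounded _ _
    [set p : R * R | `|p.1 - p.2| <= theta] (fun p => `|g p.1 - g p.2|) (2 * B).
- by exists (0, 0); rewrite /= subrr normr0.
- move=> p _; rewrite normr_ge0/=; apply: le_trans (ler_normB _ _) _.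
  by have := gB p.1; have := gB p.2; lra.
- by exists W; split => // y z yz; exact: (hW (y, z)).
Qed.

End moduli.

(** * Taylor expansion under the operator *)

Section taylor_quadrature.
Context {R : realType}.
Variables (q beta alpha : R) (n N r : nat) (w : nat -> R) (f : R -> R).
Hypotheses (q0 : 0 < q) (beta0 : 0 < beta) (n0 : (0 < n)%N) (r0 : (0 < r)%N).
Hypothesis w_ge0 : forall j, (1 <= j <= r)%N -> 0 <= w j.
Hypothesis w_sum1 : \sum_(1 <= j < r.+1) w j = 1.
Hypotheses (N0 : (0 < N)%N) (f_CN : Cdiff N f) (fN_CB : CB (derive1n N f)).

Let nR0 : 0 < n%:R :> R. Proof. by rewrite ltr0n. Qed.

Let B := quad_op q beta r w n.

Let df k (y : R) : (k < N)%N -> derivable (derive1n k f) y 1.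
Proof. by move=> kN; exact: f_CN.1. Qed.

(** Identifies the argument of [omega] in [sigma] with the radius [(1 + T) / n] for the cut-off
    [T = n ^ (1 - alpha)]. *)
Lemma theta_powR : n%:R^-1 + (n%:R `^ alpha)^-1 =
  (1 + n%:R `^ (1 - alpha)) / n%:R :> R.
Proof.
have a0 : 0 < n%:R `^ alpha :> R by exact: powR_gt0.
rewrite powRB; last by rewrite (gt_eqF nR0) implybT.
by rewrite powRr1 ?(ltW nR0)//; field; rewrite (gt_eqF nR0) (gt_eqF a0).
Qed.

(** Split [f] into its Taylor polynomial at [y] and the remainder [Rem]. By linearity the left side
    is the operator applied to [Rem], to which [quad_op_remainder] applies. *)
Lemma quad_op_taylor (y : R) : quad_converges q beta r w n f y /\
  (`|B f y - f y - \sum_(1 <= k < N.+1)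
      derive1n k f y / k`!%:R * B (fun t => (t - y) ^+ k) y|%:E <=
    sigma q beta alpha N f n)%E.
Proof.
have [C fC] := CB_bound _ fN_CB.
have th0 : 0 <= n%:R^-1 + (n%:R `^ alpha)^-1 :> R
  by rewrite addr_ge0 ?invr_ge0 ?powR_ge0.
have [M eM fM] := supnorm_bounded _ _ fC.
have [W [eW /andP[W0 _] fW]] := omega_bounded _ _ fC _ th0.
have M0 : 0 <= M := le_trans (normr_ge0 _) (fM 0).
have fact0 m : 0 < m`!%:R :> R by rewrite ltr0n fact_gt0.
pose c k := derive1n k f y / k`!%:R.
(* The term [k = N] is subtracted as well, so the Lagrange form leaves a difference of two values of
   the [N]-th derivative: at most [W] near [y], and at most [2 * M] everywhere. *)
pose Rem t := f t - \sum_(0 <= k < N.+1) c k * (t - y) ^+ k.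
have RemE t : exists2 xi, `|xi - y| <= `|t - y| &
    Rem t = (derive1n N f xi - derive1n N f y) / N`!%:R * (t - y) ^+ N.
  have [xi xit ft] := taylor_lagrange f N y t N0 (fun k kN y => df k y kN).
  exists xi => //; rewrite /Rem ft big_nat_recr//= /c opprD addrACA subrr add0r.
  by ring.
have mf : measurable_fun setT f.
  apply: continuous_measurable_fun => t.
  exact/differentiable_continuous/derivable1_diffP/(df 0%N).
have mRem : measurable_fun setT Rem.
  apply: measurable_funB => //; apply: measurable_sum => k.
  apply: measurable_funM => //; apply: measurable_funX.
  exact: measurable_funB.
pose theta : R := n%:R^-1 + (n%:R `^ alpha)^-1.
pose T : R := n%:R `^ (1 - alpha).
have T0 : 0 < T by exact: powR_gt0.
have RemW t : `|t - y| <= (1 + T) / n%:R ->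
  `|Rem t| <= W * (theta ^+ N / N`!%:R).
  rewrite /T -theta_powR -/theta => tth; have [xi xit ->] := RemE t.
  rewrite !normrM normrX normfV (ger0_norm (ltW (fact0 N))).
  rewrite [theta ^+ N / _]mulrC mulrA ler_pM ?mulr_ge0 ?exprn_ge0 ?invr_ge0
    ?(ltW (fact0 N))//.
    rewrite ler_wpM2r ?invr_ge0 ?(ltW (fact0 N))//.
    by apply: fW; exact: le_trans xit tth.
  by rewrite lerXn2r ?nnegrE.
have RemD t : `|Rem t| <= 2 * M / N`!%:R * `|t - y| ^+ N.
  have [xi _ ->] := RemE t.
  rewrite !normrM normrX normfV (ger0_norm (ltW (fact0 N))).
  rewrite ler_wpM2r ?exprn_ge0// ler_wpM2r ?invr_ge0 ?(ltW (fact0 N))//.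
  apply: le_trans (ler_normB _ _) _.
  by have := fM xi; have := fM y; lra.
have WA0 : 0 <= W * (theta ^+ N / N`!%:R).
  by rewrite mulr_ge0 ?divr_ge0 ?exprn_ge0 ?(ltW (fact0 N)).
have D0 : 0 <= 2 * M / N`!%:R by rewrite divr_ge0 ?mulr_ge0 ?(ltW (fact0 N)).
have [cRem leRem] := quad_op_remainder q beta n r w q0 beta0 n0 r0 w_ge0 w_sum1
  Rem y T _ _ N N0 T0 mRem WA0 D0 RemW RemD.
have cP k : (k < N.+1)%N -> quad_converges q beta r w n
    (fun t => (t - y) ^+ k) y.
  case: k => [_|k _]; first by have [] :=
    quad_op_cst1 q beta n r w q0 beta0 w_sum1 y.
  by have [] := quad_op_power q beta n r w q0 beta0 n0 r0 w_ge0 w_sum1 y k.+1.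
have [] := quad_op_sum q beta n r w c _ y N.+1 cP Rem cRem.
rewrite (_ : (fun t => _) = f); last first.
  by apply/funext => t; rewrite /Rem addrC subrK.
move=> cf ef; split => //.
have -> : B f y - f y - \sum_(1 <= k < N.+1) c k * B (fun t => (t - y) ^+ k) y =
    quad_op q beta r w n Rem y.
  rewrite /B ef big_ltn// (quad_op_cst1 q beta n r w q0 beta0 w_sum1 y).2.
  by rewrite {1}/c derive1n0 divr1 mulr1; ring.
rewrite /sigma eW eM -!EFinM -EFinD lee_fin; apply: le_trans leRem _.
rewrite le_eqVlt; apply/orP; left; apply/eqP; congr (_ + _).
rewrite -/T; set Z := _ * (1 + _).
(* The [2] of [2 * M] joins the [2 ^+ N.-1] of the power inequality. *)
have -> : 2 ^+ N = 2 * 2 ^+ N.-1 :> R by rewrite -exprS prednK.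
by field; rewrite expf_neq0 gt_eqF.
Qed.

End taylor_quadrature.

(** * The limit of [sigma] *)

Lemma cvg_natr_powRV {R : realType} (alpha : R) : 0 < alpha ->
  (m%:R `^ alpha)^-1 @[m --> \oo] --> (0 : R).
Proof.
move=> a0; apply/gtr0_cvgV0.
  by near=> m; rewrite powR_gt0// ltr0n; near: m; exact: nbhs_infty_gt.
have /cvgryPge nA := @cvgr_idn R; apply/cvgryPge => A; near=> m.
apply: le_trans (ler_norm A) _.
have -> : `|A| = (`|A| `^ alpha^-1) `^ alpha.
  by rewrite -powRrM mulVf ?powRr1// gt_eqF.
apply: ge0_ler_powR; rewrite ?nnegrE ?powR_ge0 ?(ltW a0)//.
near: m; exact: (nA (`|A| `^ alpha^-1)).
Unshelve. all: end_near. Qed.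

Lemma cvg_sigma {R : realType} (q beta alpha : R) (N : nat) (f : R -> R) :
  0 < q -> 0 < beta -> 0 < alpha -> (0 < N)%N -> CB (derive1n N f) ->
  sigma q beta alpha N f m @[m --> \oo] --> 0%E.
Proof.
move=> q0 b0 a0 N0 /CB_bound[C fC].
have [M eM fM] := supnorm_bounded _ _ fC.
have M0 : 0 <= M := le_trans (normr_ge0 _) (fM 0).
have qV0 : 0 <= q + q^-1 by rewrite addr_ge0 ?invr_ge0 ?(ltW q0).
pose Z : R := (q + q^-1) * expR beta * (1 + 2 ^+ N.+1 * N`!%:R / beta ^+ N).
have Z0 : 0 <= 1 + 2 ^+ N.+1 * N`!%:R / beta ^+ N.
  by rewrite addr_ge0 ?divr_ge0 ?mulr_ge0 ?exprn_ge0 ?(ltW b0).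
pose th (m : nat) : R := m%:R^-1 + (m%:R `^ alpha)^-1.
(* A majorant of [sigma]: the modulus is replaced by [2 * C] and the decaying exponential by [1].
   Both remaining powers tend to [0] because [0 < N]. *)
pose u (m : nat) : R := 2 * C / N`!%:R * th m ^+ N +
  2 ^+ N * M / N`!%:R * Z * m%:R^-1 ^+ N.
have inv0 : m%:R^-1 @[m --> \oo] --> (0 : R).
  apply/gtr0_cvgV0; last exact: cvgr_idn.
  by near=> m; rewrite ltr0n; near: m; exact: nbhs_infty_gt.
have cX (v : nat -> R) : v m @[m --> \oo] --> (0 : R) ->
  v m ^+ N @[m --> \oo] --> (0 : R).
  move=> v0; rewrite -[X in _ --> X](_ : 0 ^+ N = 0);
    last by rewrite expr0n gtn_eqF.
  by apply: (cvg_comp _ (fun x : R => x ^+ N) v0); exact: exprn_continuous.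
have u0 : u m @[m --> \oo] --> (0 : R).
  rewrite -[X in _ --> X](_ : 2 * C / N`!%:R * 0 + 2 ^+ N * M / N`!%:R * Z * 0 =
    0); last first.
    by rewrite !mulr0 addr0.
  apply: cvgD; apply: cvgM; try exact: cvg_cst; apply: cX => //.
  by rewrite -[X in _ --> X]addr0; apply: cvgD => //; exact: cvg_natr_powRV.
apply: (@squeeze_cvge _ _ _ _ (cst 0%E) _ (EFin \o u)); last 2 first.
- exact: cvg_cst.
- by apply: cvg_EFin; [exact: nearW|exact: u0].
near=> m; have m0 : (0 < m)%N by near: m; exact: nbhs_infty_gt.
have th0 : 0 <= th m by rewrite addr_ge0 ?invr_ge0 ?powR_ge0.
have [W [eW /andP[W0 WC] _]] := omega_bounded _ _ fC _ th0.
rewrite /sigma -/(th m) eW eM -!EFinM -EFinD /= !lee_fin; apply/andP; split.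
  rewrite addr_ge0// !mulr_ge0 ?invr_ge0 ?exprn_ge0 ?expR_ge0//.
rewrite /u lerD//.
  rewrite [th m ^+ N / _]mulrC mulrA ler_wpM2r ?exprn_ge0// ler_wpM2r
    ?invr_ge0//.
set E := expR (- (beta * _ / 2)).
have E1 : E <= 1.
  by rewrite -expR0 ler_expR oppr_le0 divr_ge0 ?mulr_ge0 ?powR_ge0 ?(ltW b0).
have -> : 2 ^+ N * M / N`!%:R * Z * m%:R^-1 ^+ N =
  2 ^+ N * M / (m%:R ^+ N * N`!%:R) * ((q + q^-1) * expR beta * 1 *
    (1 + 2 ^+ N.+1 * N`!%:R / beta ^+ N)).
  by rewrite /Z invfM exprVn; ring.
rewrite ler_wpM2l ?mulr_ge0 ?invr_ge0 ?mulr_ge0 ?exprn_ge0//.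
by rewrite ler_wpM2r// ler_wpM2l// mulr_ge0 ?expR_ge0.
Unshelve. all: end_near. Qed.

(** * Assembly of the four estimates *)

Theorem theorem12 (R : realType) (q beta alpha : R) (n : nat) (x : R) (N : nat)
    (f : R -> R) (r : nat) (w : nat -> R)
    (q_gt0 : 0 < q) (beta_gt0 : 0 < beta)
    (alpha_gt0 : 0 < alpha) (alpha_lt1 : alpha < 1)
    (n_gt0 : (0 < n)%N) (n_large : 2 < n%:R `^ (1 - alpha))
    (N_gt0 : (0 < N)%N) (f_CN : Cdiff N f) (fN_CB : CB (f^`(N)))
    (r_gt0 : (0 < r)%N)
    (w_ge0 : forall j, (1 <= j <= r)%N -> 0 <= w j)
    (w_sum1 : \sum_(1 <= j < r.+1) w j = 1) :
  let B := quad_op q beta r w n in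
  let s := sigma q beta alpha N f in
  [/\ (* well-definedness of the integrals *)
      quad_converges q beta r w n f x /\
      (forall k, (1 <= k <= N)%N ->
        quad_converges q beta r w n (fun t => (t - x) ^+ k) x),
      (* (i) *)
      (`|B f x - f x
         - \sum_(1 <= k < N.+1)
             (f^`(k))%classic x / k`!%:R * B (fun t => (t - x) ^+ k) x|%:E <= s n)%E /\
      s m @[m --> \oo] --> 0%E,
      (* (ii) *)
      (forall k, (1 <= k <= N)%N -> f^`(k) x = 0) ->
      (`|B f x - f x|%:E <= s n)%E,
      (* (iii) *)
      (`|B f x - f x|%:E <=
         (\sum_(1 <= k < N.+1)
            `|(f^`(k))%classic x| / k`!%:R * moment_bound q beta n k)%:E + s n)%E
    & (* (iv) *)
      (supnorm (fun y => (B f y - f y)%R) <=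
         \sum_(1 <= k < N.+1)
           supnorm (f^`(k))%classic * (k`!%:R^-1 * moment_bound q beta n k)%:E
         + s n)%E].
Proof.
move=> B s.
have taylor y := quad_op_taylor q beta alpha n N r w f q_gt0 beta_gt0 n_gt0
  r_gt0 w_ge0 w_sum1 N_gt0 f_CN fN_CB y.
have power y k : (0 < k)%N ->
    quad_converges q beta r w n (fun t => (t - y) ^+ k) y /\
    `|B (fun t => (t - y) ^+ k) y| <= moment_bound q beta n k.
  exact: quad_op_power.
(* Established at every point [y], because (iv) takes the supremum of this bound. *)
have iii y : (`|B f y - f y|%:E <= (\sum_(1 <= k < N.+1)
    `|(f^`(k))%classic y| / k`!%:R * moment_bound q beta n k)%:E + s n)%E.
  have [_] := taylor y; rewrite -/B -/s; set S := \sum_(_ <= _ < _) _ => hS.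
  have SM : `|S| <= \sum_(1 <= k < N.+1)
      `|(f^`(k))%classic y| / k`!%:R * moment_bound q beta n k.
    apply: le_trans (ler_norm_sum _ _ _) _; apply: ler_sum_nat => k /andP[k0 _].
    rewrite !normrM normfV (ger0_norm (ler0n _ _)) ler_wpM2l ?divr_ge0//.
    by have [] := power y k k0.
  apply: (@le_trans _ _ (`|S|%:E + `|B f y - f y - S|%:E)%E).
    by rewrite -EFinD lee_fin -[X in `|X| <= _](subrK S) addrC ler_normD.
  by rewrite leeD// lee_fin.
split.
- split; first by have [] := taylor x.
  by move=> k /andP[k0 _]; have [] := power x k k0.
- by split; [have [] := taylor x|exact: cvg_sigma].
- move=> f0; have [_] := taylor x; rewrite -/B -/s big1_seq ?subr0//.
  by move=> k /andP[_]; rewrite mem_index_iota => kN; rewrite f0 ?mul0r.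
- exact: iii.
apply: ge_ereal_sup => _ [y _ <-]; apply: le_trans (iii y) _.
rewrite leeD2r// -sumEFin big_nat [leRHS]big_nat lee_sum// => k /andP[k0 _].
rewrite -mulrA EFinM lee_wpmul2r//.
  rewrite lee_fin mulr_ge0 ?invr_ge0//.
  (* [moment_bound] is nonnegative because it dominates an absolute value. *)
  by have [_] := power y k k0; apply: le_trans.
by apply: ereal_sup_ubound; exists y.
Qed.
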